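(* Let $\bm{S}\in\mathbb{C}^{s\times n}$ be any matrix and let $\bm{V}\in\mathbb{C}^{n\times m}$ be a (generally non-orthogonal) basis of an $m$-dimensional subspace $\mathcal{V}\subset\mathbb{C}^n$. Then, for every $\bm{v}\in\mathcal{V}$, $$ \frac{\sigma_{\min}^2(\bm{S}\bm{V})}{\sigma_{\max}^2(\bm{V})}\|\bm{v}\|_2^2 \;\leq\; \|\bm{S}\bm{v}\|_2^2 \;\leq\; \frac{\sigma_{\max}^2(\bm{S}\bm{V})}{\sigma_{\min}^2(\bm{V})}\,\|\bm{v}\|_2^2 . $$
   Context: That $\bm{V}\in\mathbb{C}^{n\times m}$ is a basis of $\mathcal{V}$ means that its $m$ columns are linearly independent and span $\mathcal{V}$ (so $\bm{V}$ has full column rank and $\mathcal{V}=\mathrm{Ran}(\bm{V})$). For a matrix $\bm{M}$ with $m$ columns, $\sigma_{\max}(\bm{M})$ and $\sigma_{\min}(\bm{M})$ denote its largest and smallest singular values, i.e. the square roots of the largest and smallest eigenvalues of the $m\times m$ matrix $\bm{M}^\ast\bm{M}$, where $\bm{M}^\ast$ is the conjugate transpose (in particular $\sigma_{\min}(\bm{M})=0$ if $\bm{M}$ has fewer rows than columns). $\|\cdot\|_2$ is the Euclidean norm. *)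

(* Defs.v *)
From mathcomp Require Export all_boot all_order all_algebra.
From mathcomp Require Export spectral.
From mathcomp Require Export complex.
From mathcomp Require Export classical_sets reals.

Set Implicit Arguments.
Unset Strict Implicit.
Unset Printing Implicit Defensive.

Import Order.TTheory GRing.Theory Num.Theory.

Local Open Scope ring_scope.
Local Open Scope complex_scope.
Local Open Scope sesquilinear_scope.
Local Open Scope classical_set_scope.

Definition gram_mx (R : realType) (k m : nat) (M : 'M[R[i]]_(k, m)) :
  'M[R[i]]_m := M ^t* *m M.

(* The eigenvalues of M^* M, as real numbers: gram_eigenvalue_ge0 shows that
   restricting to real values loses none of them. *)
Definition gram_spectrum (R : realType) (k m : nat) (M : 'M[R[i]]_(k, m)) :
  set R := [set x | eigenvalue (gram_mx M) x%:C].

(* For 0 < m the supremum and infimum are attained (see sigma_maxP and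
   sigma_minP); for m = 0 the spectrum is empty and both values are 0. *)
Definition sigma_max (R : realType) (k m : nat) (M : 'M[R[i]]_(k, m)) : R :=
  Num.sqrt (sup (gram_spectrum M)).

Definition sigma_min (R : realType) (k m : nat) (M : 'M[R[i]]_(k, m)) : R :=
  Num.sqrt (inf (gram_spectrum M)).

Definition norm2 (R : realType) (n : nat) (v : 'cV[R[i]]_n) : R :=
  Num.sqrt (\sum_(i < n) Normc.normc (v i 0) ^+ 2).

Lemma dot_ge0 (R : realType) (n : nat) (v : 'cV[R[i]]_n) :
  0 <= (v ^t* *m v) 0 0.
Proof.
rewrite mxE; apply: sumr_ge0 => i _.
by rewrite !mxE mulrC mul_conjC_ge0.
Qed.

Lemma dot_gt0 (R : realType) (n : nat) (v : 'cV[R[i]]_n) :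
  v != 0 -> 0 < (v ^t* *m v) 0 0.
Proof.
move=> v0; rewrite lt_def dot_ge0 andbT; apply: contra_neq v0 => e.
apply/colP => i; rewrite [RHS]mxE; apply/eqP; move/eqP: e.
rewrite mxE psumr_eq0 => [/allP/(_ i (mem_index_enum _))|j _].
  by rewrite /= !mxE mulrC mul_conjC_eq0.
by rewrite !mxE mulrC mul_conjC_ge0.
Qed.

Lemma gram_eigenvalue_ge0 (R : realType) (k m : nat) (M : 'M[R[i]]_(k, m))
  (a : R[i]) : eigenvalue (gram_mx M) a -> 0 <= a.
Proof.
case/eigenvalueP => w wM w0.
pose u := w ^t*.
have uK : u ^t* = w by apply/matrixP => i j; rewrite !mxE conjCK.
have u0 : u != 0.
  apply: contra_neq w0 => u0; rewrite -uK u0.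
  by apply/matrixP => i j; rewrite !mxE conjC0.
have e : (M *m u) ^t* *m (M *m u) = a *: (u ^t* *m u).
  rewrite uK scalemxAl -wM /gram_mx !mulmxA; congr (_ *m _ *m _).
  by rewrite trmx_mul map_mxM /= uK.
move: (dot_ge0 (M *m u)); rewrite e mxE.
by rewrite pmulr_lge0 // dot_gt0.
Qed.

Lemma gram_spectrum_seq (R : realType) (k m : nat) (M : 'M[R[i]]_(k, m)) :
  exists2 s : seq R, size s = m & gram_spectrum M = [set` s].
Proof.
have [rs ers] := closed_field_poly_normal (char_poly (gram_mx M)).
rewrite (monicP (char_poly_monic _)) scale1r in ers.
have rsP a : eigenvalue (gram_mx M) a = (a \in rs).
  by rewrite eigenvalue_root_char ers root_prod_XsubC.
exists (map (@complex.Re R) rs).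
  rewrite size_map; have := size_char_poly (gram_mx M).
  by rewrite ers size_prod_XsubC => -[].
apply/seteqP; split => x /=.
  by rewrite /gram_spectrum /= rsP => xrs; apply/mapP; exists x%:C.
case/mapP => a ars ->; rewrite /gram_spectrum /=.
have aM : eigenvalue (gram_mx M) a by rewrite rsP.
by rewrite RRe_real // ger0_real // (gram_eigenvalue_ge0 aM).
Qed.

Lemma seq_max (R : realType) (s : seq R) : (0 < size s)%N ->
  exists2 x, x \in s & forall y, y \in s -> y <= x.
Proof.
elim: s => // a [|b s] IH _.
  by exists a; rewrite ?mem_head // => y; rewrite inE => /eqP ->.
have [//|x xs xmax] := IH.
have [ax|xa] := leP a x.
  exists x; first by rewrite inE xs orbT.
  by move=> y; rewrite inE => /predU1P[->|/xmax].
exists a; first exact: mem_head.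
move=> y; rewrite inE => /predU1P[->//|/xmax yx].
exact: le_trans yx (ltW xa).
Qed.

Lemma sup_seq (R : realType) (s : seq R) : (0 < size s)%N ->
  sup [set` s] \in s /\ forall y, y \in s -> y <= sup [set` s].
Proof.
move=> /seq_max[x xs xmax].
have -> : sup [set` s] = x; last by [].
apply/eqP; rewrite eq_le; apply/andP; split.
  by apply: ge_sup => [|y]; [exists x | exact: xmax].
by apply: ub_le_sup => //; exists x => y; exact: xmax.
Qed.

Lemma inf_seq (R : realType) (s : seq R) : (0 < size s)%N ->
  inf [set` s] \in s /\ forall y, y \in s -> inf [set` s] <= y.
Proof.
move=> s0; have [] := @sup_seq R (map -%R s); first by rewrite size_map.
have -> : [set` map -%R s] = -%R @` [set` s].
  apply/seteqP; split => y /=.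
    by case/mapP => z zs ->; exists z.
  by case=> z zs <-; exact: map_f.
rewrite /inf => /mapP[z zs ->] h; rewrite opprK; split => // y ys.
by rewrite -lerN2; apply: h; exact: map_f.
Qed.

Lemma sigma_maxP (R : realType) (k m : nat) (M : 'M[R[i]]_(k, m)) :
  (0 < m)%N ->
  eigenvalue (gram_mx M) (sigma_max M ^+ 2)%:C /\
  forall a, eigenvalue (gram_mx M) a -> a <= (sigma_max M ^+ 2)%:C.
Proof.
have [s sm es] := gram_spectrum_seq M; move=> m0; have := m0; rewrite -[X in (0 < X)%N -> _]sm => /sup_seq[].
rewrite -es => m1 m2.
have e1 : eigenvalue (gram_mx M) (sup (gram_spectrum M))%:C.
  suff : gram_spectrum M (sup (gram_spectrum M)) by [].
  by rewrite [X in X (sup _)]es.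
have h0 : 0 <= sup (gram_spectrum M).
  by rewrite -lecR; exact: gram_eigenvalue_ge0 e1.
rewrite /sigma_max sqr_sqrtr //; split => // a ha.
have ra : (complex.Re a)%:C = a.
  by rewrite RRe_real // ger0_real // (gram_eigenvalue_ge0 ha).
rewrite -ra lecR; apply: m2.
suff : [set` s] (complex.Re a) by [].
by rewrite -es /gram_spectrum /= ra.
Qed.

Lemma sigma_minP (R : realType) (k m : nat) (M : 'M[R[i]]_(k, m)) :
  (0 < m)%N ->
  eigenvalue (gram_mx M) (sigma_min M ^+ 2)%:C /\
  forall a, eigenvalue (gram_mx M) a -> (sigma_min M ^+ 2)%:C <= a.
Proof.
have [s sm es] := gram_spectrum_seq M; move=> m0; have := m0; rewrite -[X in (0 < X)%N -> _]sm => /inf_seq[].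
rewrite -es => m1 m2.
have e1 : eigenvalue (gram_mx M) (inf (gram_spectrum M))%:C.
  suff : gram_spectrum M (inf (gram_spectrum M)) by [].
  by rewrite [X in X (inf _)]es.
have h0 : 0 <= inf (gram_spectrum M).
  by rewrite -lecR; exact: gram_eigenvalue_ge0 e1.
rewrite /sigma_min sqr_sqrtr //; split => // a ha.
have ra : (complex.Re a)%:C = a.
  by rewrite RRe_real // ger0_real // (gram_eigenvalue_ge0 ha).
rewrite -ra lecR; apply: m2.
suff : [set` s] (complex.Re a) by [].
by rewrite -es /gram_spectrum /= ra.
Qed.

(* Main.v *)
Require Import Defs.

(** Since the columns of [V] span [U], write [v = V x].  Everything then
    reduces to the Rayleigh bounds
      [sigma_min M ^ 2 * |x| ^ 2 <= |M x| ^ 2 <= sigma_max M ^ 2 * |x| ^ 2],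
    used for [M = S V] and for [M = V]: the first instance compares [|S v|]
    with [|x|], the second compares [|x|] with [|v|].  In the upper bound one
    also divides by [sigma_min V ^ 2], which is positive because the columns of
    [V] are linearly independent (unless [m = 0], and then [v = 0]).

    The Rayleigh bounds follow from the spectral theorem: with
    [M^* M = P^* D P], [P] unitary and [D] diagonal, [|M x| ^ 2] is the sum of
    the [D_i |(P x)_i| ^ 2], while [|x| ^ 2] is the sum of the
    [|(P x)_i| ^ 2], and every [D_i] is an eigenvalue of [M^* M]. *)

Set Implicit Arguments.
Unset Strict Implicit.
Unset Printing Implicit Defensive.

Import Order.TTheory GRing.Theory Num.Theory.

Local Open Scope ring_scope.
Local Open Scope complex_scope.
Local Open Scope sesquilinear_scope.

Lemma adjmxM (C : numClosedFieldType) (m n p : nat)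
  (A : 'M[C]_(m, n)) (B : 'M[C]_(n, p)) : (A *m B) ^t* = B ^t* *m A ^t*.
Proof. by rewrite trmx_mul map_mxM. Qed.

Lemma dotE (C : numClosedFieldType) (n : nat) (v : 'cV[C]_n) :
  (v ^t* *m v) 0 0 = \sum_(i < n) `|v i 0| ^+ 2.
Proof. by rewrite mxE; apply: eq_bigr => i _; rewrite !mxE normCKC. Qed.

Lemma dot_unitary (C : numClosedFieldType) (n : nat) (P : 'M[C]_n)
  (x : 'cV[C]_n) :
  P \is unitarymx -> (P *m x) ^t* *m (P *m x) = x ^t* *m x.
Proof.
move=> Pu; rewrite adjmxM -mulmxA (mulmxA _ P) -(invmx_unitary Pu).
by rewrite mulVmx ?unitarymx_unit // mul1mx.
Qed.

Lemma eigenvalue_spectral_diag (C : numClosedFieldType) (n : nat)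
  (A : 'M[C]_n) (i : 'I_n) :
  A \is normalmx -> eigenvalue A (spectral_diag A 0 i).
Proof.
move=> /orthomx_spectralP eA; have Pu := spectral_unit A.
(* Eigenvectors here are row vectors: A = P^-1 D P makes row i of P one. *)
apply/eigenvalueP; exists (row i (spectralmx A)).
  rewrite {2}eA -row_mul !mulmxA mulmxV // mul1mx row_mul row_diag_mx.
  by rewrite -scalemxAl -rowE.
apply: contraTneq Pu => P0; rewrite -row_free_unit -kermx_eq0.
apply/rowV0Pn; exists (delta_mx 0 i).
  by apply/sub_kermxP; rewrite -rowE.
by apply/eqP => /matrixP/(_ 0 i); rewrite !mxE !eqxx; apply/eqP/oner_neq0.
Qed.

(** A normal matrix is diagonal in the orthonormal basis of its spectral
    decomposition, in which the quadratic form is a weighted sum of squares. *)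
Lemma quad_spectral (C : numClosedFieldType) (n : nat) (A : 'M[C]_n)
  (x : 'cV[C]_n) : A \is normalmx ->
  (x ^t* *m A *m x) 0 0 =
  \sum_(i < n) spectral_diag A 0 i * `|(spectralmx A *m x) i 0| ^+ 2.
Proof.
move=> /orthomx_spectralP eA.
set P := spectralmx A; set d := spectral_diag A.
have -> : x ^t* *m A *m x = (P *m x) ^t* *m (diag_mx d *m (P *m x)).
  rewrite {1}eA -/P -/d adjmxM -(invmx_unitary (spectral_unitarymx A)).
  by rewrite !mulmxA.
rewrite mxE; apply: eq_bigr => i _.
by rewrite mul_diag_mx !mxE normCKC mulrCA.
Qed.

Section Rayleigh.
Variable R : realType.

Lemma norm2_sqrE (n : nat) (v : 'cV[R[i]]_n) :
  (norm2 v ^+ 2)%:C = (v ^t* *m v) 0 0.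
Proof.
rewrite dotE sqr_sqrtr; last by apply: sumr_ge0 => i _; exact: sqr_ge0.
rewrite rmorph_sum; apply: eq_bigr => i _; rewrite rmorphXn.
by case: (v i 0).
Qed.

Lemma gram_normal (k m : nat) (M : 'M[R[i]]_(k, m)) :
  gram_mx M \is normalmx.
Proof. by apply/normalmxP; rewrite /gram_mx adjmxM trmxCK. Qed.

Lemma norm2_sqr_mulmx (k m : nat) (M : 'M[R[i]]_(k, m)) (x : 'cV[R[i]]_m) :
  (norm2 (M *m x) ^+ 2)%:C =
  \sum_(i < m) spectral_diag (gram_mx M) 0 i *
               `|(spectralmx (gram_mx M) *m x) i 0| ^+ 2.
Proof.
rewrite norm2_sqrE -(quad_spectral x (gram_normal M)) adjmxM /gram_mx.
by rewrite !mulmxA.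
Qed.

Lemma norm2_sqr_spectral (m : nat) (A : 'M[R[i]]_m) (x : 'cV[R[i]]_m) :
  (norm2 x ^+ 2)%:C = \sum_(i < m) `|(spectralmx A *m x) i 0| ^+ 2.
Proof.
by rewrite norm2_sqrE -(dot_unitary x (spectral_unitarymx A)) dotE.
Qed.

(** The bound also holds for [m = 0]: the sums over indices are then empty, and
    an index [i < m] is what shows that the spectrum is nonempty. *)
Lemma sigma_max_bound (k m : nat) (M : 'M[R[i]]_(k, m)) (x : 'cV[R[i]]_m) :
  norm2 (M *m x) ^+ 2 <= sigma_max M ^+ 2 * norm2 x ^+ 2.
Proof.
rewrite -lecR [(_ * norm2 x ^+ 2)%:C]rmorphM norm2_sqr_mulmx /=.
rewrite (norm2_sqr_spectral (gram_mx M)).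
rewrite mulr_sumr; apply: ler_sum => i _.
have m0 : (0 < m)%N := leq_ltn_trans (leq0n i) (ltn_ord i).
apply: ler_wpM2r; first exact: exprn_ge0.
have [_] := sigma_maxP M m0; apply.
exact/eigenvalue_spectral_diag/gram_normal.
Qed.

Lemma sigma_min_bound (k m : nat) (M : 'M[R[i]]_(k, m)) (x : 'cV[R[i]]_m) :
  sigma_min M ^+ 2 * norm2 x ^+ 2 <= norm2 (M *m x) ^+ 2.
Proof.
rewrite -lecR [(_ * norm2 x ^+ 2)%:C]rmorphM norm2_sqr_mulmx /=.
rewrite (norm2_sqr_spectral (gram_mx M)).
rewrite mulr_sumr; apply: ler_sum => i _.
have m0 : (0 < m)%N := leq_ltn_trans (leq0n i) (ltn_ord i).
apply: ler_wpM2r; first exact: exprn_ge0.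
have [_] := sigma_minP M m0; apply.
exact/eigenvalue_spectral_diag/gram_normal.
Qed.

Lemma sigma_min_sqr_gt0 (k m : nat) (M : 'M[R[i]]_(k, m)) : (0 < m)%N ->
  (forall x : 'cV[R[i]]_m, M *m x = 0 -> x = 0) -> 0 < sigma_min M ^+ 2.
Proof.
move=> m0 Minj; rewrite lt_def sqr_ge0 andbT; apply/eqP => s0.
have [] := sigma_minP M m0; rewrite s0 => /eigenvalueP[w wG w0] _.
rewrite scale0r in wG.
(* The adjoint u of a null row vector w of M^* M satisfies |M u|^2 = 0. *)
move/eqP: w0; apply.
suff w0 : w ^t* = 0.
  by rewrite -[w]trmxCK w0; apply/matrixP => i j; rewrite !mxE conjC0.
apply: Minj; apply/eqP; apply: contraTT isT => /dot_gt0.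
by rewrite adjmxM trmxCK mulmxA -(mulmxA w) -/(gram_mx M) wG mul0mx mxE ltxx.
Qed.

Lemma norm2_0 (n : nat) : norm2 (0 : 'cV[R[i]]_n) = 0.
Proof.
apply/eqP; rewrite -sqrf_eq0; apply/eqP/complexI.
by rewrite norm2_sqrE mulmx0 mxE.
Qed.

End Rayleigh.

Lemma mulmx_sum_col (F : fieldType) (n m : nat) (V : 'M[F]_(n, m))
  (x : 'cV[F]_m) : V *m x = \sum_(j < m) x j 0 *: col j V.
Proof.
apply/colP => i; rewrite summxE mxE; apply: eq_bigr => j _.
by rewrite !mxE mulrC.
Qed.

Lemma size_cols (F : fieldType) (n m : nat) (V : 'M[F]_(n, m)) :
  size [seq col j V | j <- enum 'I_m] == m.
Proof. by rewrite size_map size_enum_ord. Qed.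

Lemma nth_cols (F : fieldType) (n m : nat) (V : 'M[F]_(n, m)) (j : 'I_m) :
  [seq col i V | i <- enum 'I_m]`_j = col j V.
Proof. by rewrite (nth_map j) ?size_enum_ord // nth_ord_enum. Qed.

Lemma span_cols (F : fieldType) (n m : nat) (V : 'M[F]_(n, m))
  (v : 'cV[F]_n) : v \in <<[seq col j V | j <- enum 'I_m]>>%VS ->
  exists x : 'cV[F]_m, v = V *m x.
Proof.
move=> vV; exists (\col_j coord (Tuple (size_cols V)) j v).
rewrite mulmx_sum_col {1}(coord_span (X := Tuple (size_cols V)) vV).
by apply: eq_bigr => j _; rewrite !mxE nth_cols.
Qed.

Lemma free_cols (F : fieldType) (n m : nat) (V : 'M[F]_(n, m)) :
  free [seq col j V | j <- enum 'I_m] ->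
  forall x : 'cV[F]_m, V *m x = 0 -> x = 0.
Proof.
move=> /(@freeP _ _ _ (Tuple (size_cols V))) fV x Vx0; apply/colP => j.
rewrite [RHS]mxE; apply: (fV (fun j => x j 0)).
by rewrite -[RHS]Vx0 mulmx_sum_col; apply: eq_bigr => i _; rewrite nth_cols.
Qed.

Theorem proposition3p1 (R : realType) (s n m : nat)
  (S : 'M[R[i]]_(s, n)) (V : 'M[R[i]]_(n, m))
  (U : {vspace 'cV[R[i]]_n}) (dimU : (\dim U = m)%N)
  (basisV : basis_of U [seq col j V | j <- enum 'I_m])
  (v : 'cV[R[i]]_n) (vU : v \in U) :
  sigma_min (S *m V) ^+ 2 / sigma_max V ^+ 2 * norm2 v ^+ 2
    <= norm2 (S *m v) ^+ 2
  /\ norm2 (S *m v) ^+ 2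
    <= sigma_max (S *m V) ^+ 2 / sigma_min V ^+ 2 * norm2 v ^+ 2.
Proof.
have [/eqP spanV freeV] := andP basisV.
rewrite -spanV in vU; have [x ->] := span_cols vU.
rewrite mulmxA -![_ / _ * _]mulrA; split.
  apply: le_trans _ (sigma_min_bound (S *m V) x); apply: ler_wpM2l.
    exact: sqr_ge0.
  (* When sigma_max V = 0 the inverse is 0 by convention: nothing to prove. *)
  have [s0|s_neq0] := eqVneq (sigma_max V ^+ 2) 0.
    by rewrite s0 invr0 mul0r sqr_ge0.
  rewrite ler_pdivrMl; first exact: sigma_max_bound.
  by rewrite lt_def s_neq0 sqr_ge0.
apply: le_trans (sigma_max_bound (S *m V) x) _; apply: ler_wpM2l.
  exact: sqr_ge0.
have [m0|m_gt0] := posnP m.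
  (* There are no columns: x is the empty vector, so its norm is 0. *)
  have -> : x = 0 by apply/colP => j; have := ltn_ord j; rewrite {2}m0.
  by rewrite mulmx0 !norm2_0 expr0n mulr0.
rewrite ler_pdivlMl; first exact: sigma_min_bound.
exact: sigma_min_sqr_gt0 m_gt0 (free_cols freeV).
Qed.
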